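(* Let $\alpha > 0$ be a real number. If $\lambda(\alpha) < 3\alpha$, then $g(n) \ll_{\alpha} n^{\alpha}$; that is, there is a constant $K_\alpha>0$ depending only on $\alpha$ such that $g(n) \le K_\alpha\, n^{\alpha}$ for all positive integers $n$.
   Context: Write $[n] := \{1,2,\ldots,n\}$. A set $A$ of positive integers is called a multiplicative Sidon set if for all $a,b,c,d \in A$ (not necessarily distinct), $ab = cd$ implies the equality of sets $\{a,b\} = \{c,d\}$. For a positive integer $n$, $g(n)$ denotes the infimum of all real numbers $L$ such that there exists a multiplicative Sidon subset of $[n]$ which has non-empty intersection with every sub-interval $[x, x+L] \subseteq [1,n]$ of length $L$ (here $x$ is real). For a positive real number $\alpha$, $\lambda(\alpha)$ denotes the smallest non-negative real number such that, for all $\varepsilon > 0$ and all large enough $n$ (in terms of $\alpha$ and $\varepsilon$), the Lebesgue measure of the set of real $x \in [0,n]$ for which the interval $(x, x+x^{\alpha}]$ contains fewer than $5^{1/\alpha}$ primes is smaller than $n^{\lambda(\alpha)+\varepsilon}$. *)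

(* Defs.v *)
From HB Require Import structures.
From mathcomp Require Import all_boot all_order all_algebra.
From mathcomp Require Import finmap.
From mathcomp Require Import all_classical all_reals all_analysis.

Set Implicit Arguments.
Unset Strict Implicit.
Unset Printing Implicit Defensive.

Import Order.TTheory GRing.Theory Num.Theory.
Import numFieldNormedType.Exports.

Local Open Scope classical_set_scope.
Local Open Scope ring_scope.

Definition mult_sidon (A : set nat) : Prop :=
  (forall a, A a -> (0 < a)%N) /\
  (forall a b c d : nat, A a -> A b -> A c -> A d ->
    (a * b)%N = (c * d)%N -> [set a; b] = [set c; d]).

Definition meets_intervals (R : realType) (n : nat) (A : set nat) (L : R) : Prop :=
  forall x : R, `[x, x + L] `<=` `[1, n%:R] ->
    ([set a%:R | a in A] `&` `[x, x + L]) !=set0.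

Definition sidon_gap (R : realType) (n : nat) : set R :=
  [set L | 0 <= L /\ exists A : set nat,
    [/\ A `<=` [set a | (1 <= a <= n)%N], mult_sidon A & meets_intervals n A L]].

Definition g (R : realType) (n : nat) : R := inf (@sidon_gap R n).

Definition primes_in (R : realType) (x y : R) : set nat :=
  [set p | prime p /\ x < p%:R <= y].

Definition prime_count (R : realType) (x y : R) : nat :=
  #|` fset_set (primes_in x y)|.

Definition few_primes (R : realType) (alpha : R) (n : nat) : set R :=
  [set x | 0 <= x <= n%:R /\
    (prime_count x (x + x `^ alpha))%:R < 5 `^ alpha^-1].

Definition exceptional_exponent (R : realType) (alpha : R) : set R :=
  [set l | 0 <= l /\ forall eps : R, 0 < eps ->
    \forall n \near \oo,
      (lebesgue_measure (few_primes alpha n) < (n%:R `^ (l + eps))%:E)%E].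

(* The infimum is attained, see [lambda_exponent] and [lambda_least]. *)
Definition lambda (R : realType) (alpha : R) : R :=
  inf (exceptional_exponent alpha).

(* [fset_set] is only meaningful on finite sets. *)
Lemma finite_primes_in (R : realType) (x y : R) : finite_set (primes_in x y).
Proof.
apply: sub_finite_set (finite_II (Num.truncn y).+1).
move=> p /= [_ /andP[_ py]]; rewrite ltnS truncn_ge_nat ?(le_trans (ler0n R p) py)//.
Qed.

(* [inf] is only meaningful on nonempty sets that are bounded below. *)
Lemma has_inf_sidon_gap (R : realType) (n : nat) : has_inf (@sidon_gap R n).
Proof.
split; last by exists 0 => L [].
exists n%:R; split; first exact: ler0n.
exists set0; split; [by move=> a [] | by split => [a []|a b c d []] | ].
move=> x sub; exfalso.
have xx : x <= x + n%:R by rewrite lerDl ler0n.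
have /sub : `[x, x + n%:R]%classic x by rewrite /= in_itv /= lexx.
have /sub : `[x, x + n%:R]%classic (x + n%:R) by rewrite /= in_itv /= lexx xx.
rewrite /= !in_itv /= => /andP[_ h] /andP[h1 _].
have : 1 + n%:R <= n%:R :> R by apply: le_trans h; rewrite lerD2r.
by rewrite gerDr ler10.
Qed.

Lemma exceptional_exponent1 (R : realType) (alpha : R) :
  exceptional_exponent alpha 1.
Proof.
split=> // eps eps0; near=> n.
have n2 : (2 <= n)%N by near: n; exists 2%N.
apply: (@le_lt_trans _ _ (lebesgue_measure (`[0, n%:R]%classic : set R))).
  apply: le_outer_measure => x /= [x0 _].
  by rewrite in_itv.
rewrite lebesgue_measure_itv /= lte_fin ltr0n (leq_trans _ n2)//.
rewrite -EFinB subr0 lte_fin powRD ?powRr1//; last first.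
  by rewrite pnatr_eq0 -lt0n (leq_trans _ n2)// implybT.
rewrite ltr_pMr ?ltr0n ?(leq_trans _ n2)//.
apply: (@le_lt_trans _ _ (1 `^ eps)); first by rewrite powR1.
by apply: gt0_ltr_powR; rewrite ?nnegrE ?ltr1n.
Unshelve. all: by end_near. Qed.

Lemma lambda_least (R : realType) (alpha l : R) :
  exceptional_exponent alpha l -> lambda alpha <= l.
Proof. by move=> h; apply: ge_inf => //; exists 0 => ? []. Qed.

Lemma lambda_exponent (R : realType) (alpha : R) :
  exceptional_exponent alpha (lambda alpha).
Proof.
have ne : exceptional_exponent alpha !=set0.
  by exists 1; exact: exceptional_exponent1.
split; first by apply: lb_le_inf => // l [].
move=> eps eps0.
have [l [l0 lE] ll] : exists2 l, exceptional_exponent alpha l &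
    l < lambda alpha + eps / 2.
  apply: inf_adherent; first by rewrite divr_gt0.
  by split=> //; exists 0 => ? [].
have := lE (eps / 2); rewrite divr_gt0 // => /(_ isT) nE.
near=> n; apply: (@lt_le_trans _ _ (n%:R `^ (l + eps / 2))%:E).
  by near: n.
have n1 : (1 <= n)%N by near: n; exists 1%N.
rewrite lee_fin ler_powR ?ler1n // [X in _ <= _ + X]splitr addrA lerD2r.
exact: ltW.
Unshelve. all: by end_near. Qed.

(* Main.v *)
Require Import Defs.
From HB Require Import structures.
From mathcomp Require Import all_boot all_order all_algebra.
From mathcomp Require Import lra zify ring.

(** Cut [1, n] into blocks of length H, about n^alpha. All but n^(2 alpha - delta)
    blocks are rich, i.e. contain at least 2t primes, where t = floor(1/alpha)
    bounds the number of primes above H dividing an integer up to n.  In each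
    rich block we select one of 2t primes; a random selection kills (divides) a
    given integer with probability at most 1/2, so some selection leaves an
    unkilled integer in every cell of about log n consecutive integers.  The
    remaining (poor) blocks thus have M > n^(alpha - eta) candidates each.  Since
    m has only n^o(1) divisors for m <= n^2, a random choice of candidates has,
    for each poor block, an expected number of solutions of ab = cd through it that is
    O(n^o(1) * #poor / M^2) = o(1).  A counting form of the local lemma,
    due to Rosenfeld, provides a choice without nontrivial solutions.  The
    selected primes divide none of these candidates, so they can be added
    without destroying the Sidon property. *)

Set Implicit Arguments.
Unset Strict Implicit.
Unset Printing Implicit Defensive.

Import Order.TTheory GRing.Theory Num.Theory.

Local Open Scope ring_scope.

(** * Transversals avoiding a light hypergraph *)

Section Transversal.
Variable R : realFieldType.
Variables (I : finType) (M : nat).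
Implicit Types (f : {ffun I -> 'I_M}) (E : {set I * 'I_M}) (X : {set {ffun I -> 'I_M}}).

Definition set_coord f i q : {ffun I -> 'I_M} := [ffun j => if j == i then q else f j].

Definition through f E := [forall x in E, f x.1 == x.2].

Definition support E : {set I} := [set x.1 | x in E].

(** The free coordinates are those in [S]: membership in [X] is decided by the values outside
    [S]. *)
Definition cylinder (S : {set I}) X := forall f i q, f \in X -> i \in S -> set_coord f i q \in X.

(** Resampling coordinate [i] stays inside [X], and the overwritten value is known to be [q], so the
    pair of [f] and the new value can be recovered. *)
Lemma card_coord X i q :
  cylinder [set i] X -> (#|[set f in X | f i == q]| * M <= #|X|)%N.
Proof.
move=> cylX; rewrite -[M in (_ * M)%N]card_ord -cardsT -cardsX.
rewrite -(@card_in_imset _ _ (fun x => set_coord x.1 i x.2)).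
  apply/subset_leq_card/subsetP => g /imsetP[[f r] /setXP[fP _] ->].
  by move: fP; rewrite inE => /andP[fX _]; apply: cylX; rewrite ?inE.
move=> [f r] [f' r'] /setXP[fP _] /setXP[f'P _] /ffunP eq_set.
move: fP f'P; rewrite !inE => /andP[_ /eqP fi] /andP[_ /eqP f'i].
have := eq_set i; rewrite !ffunE eqxx /= => ->; congr (_, _).
apply/ffunP => j; have := eq_set j; rewrite !ffunE /=.
by case: eqP => // -> _; rewrite fi f'i.
Qed.

Lemma through_set_coord f i q E :
  i \notin support E -> through (set_coord f i q) E = through f E.
Proof.
move=> iE; apply: eq_forallb => x; case: (boolP (x \in E)) => //= xE.
rewrite ffunE; have [xi|//] := eqVneq x.1 i; case/negP: iE.
by rewrite -xi; apply: imset_f.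
Qed.

(** The points of [E] are fixed one at a time, each costing a factor [M] by [card_coord]. *)
Lemma card_through X E :
  cylinder (support E) X -> (#|[set f in X | through f E]| * M ^ #|E| <= #|X|)%N.
Proof.
move cardE: #|E| => m; elim: m E cardE X => [|m IHm] E cardE X cylX.
  by rewrite muln1 subset_leq_card //; apply/subsetP => f; rewrite inE => /andP[].
have [x xE] : {x | x \in E} by apply/sigW/set0Pn; rewrite -card_gt0 cardE.
have cardE' : #|E :\ x| = m by have := cardsD1 x E; rewrite xE cardE => -[].
have subE : support (E :\ x) \subset support E by apply/imsetS/subD1set.
have cylE' Y : cylinder (support E) Y -> cylinder (support (E :\ x)) Y.
  by move=> cylY f i q fY iE; apply: cylY => //; apply: (subsetP subE).
have [/imsetP[y yE xy]|xE'] := boolP (x.1 \in support (E :\ x)).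
  suff -> : [set f in X | through f E] = set0 by rewrite cards0.
  apply/setP => f; rewrite !inE; apply/negP => /andP[_ /forall_inP fE].
  move: yE; rewrite !inE => /andP[/negP yx yE]; apply: yx.
  rewrite -pair_eqE /pair_eq /= -xy eqxx /=.
  by rewrite -(eqP (fE _ yE)) -(eqP (fE _ xE)) xy.
rewrite expnS mulnA.
apply: leq_trans (IHm _ cardE' X (cylE' _ cylX)).
rewrite leq_mul2r; apply/orP; right.
have -> : [set f in X | through f E] =
    [set f in [set f in X | through f (E :\ x)] | f x.1 == x.2].
  apply/setP => f; rewrite !inE -andbA; congr (_ && _).
  apply/forall_inP/andP => [fE|[/forall_inP fE fx] y yE].
    split; last exact: fE.
    by apply/forall_inP => y /setD1P[_ yE]; apply: fE.
  have [->//|yx] := eqVneq y x; apply: fE.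
  by rewrite !inE yx.
apply: card_coord => f i q; rewrite !inE => /andP[fX fE] /eqP ->.
  by rewrite through_set_coord // fE andbT; apply: cylX => //; apply: imset_f.
Qed.

Variables (K : finType) (P : pred K) (e : K -> {set I * 'I_M}).

(** Only edges supported inside [S] are forbidden, so constraints can be added coordinate by
    coordinate while those outside [S] stay free. *)
Definition avoiding (S : {set I}) :=
  [set f | [forall k, P k && (support (e k) \subset S) ==> ~~ through f (e k)]].

Lemma avoidingS (S S' : {set I}) : S \subset S' -> avoiding S' \subset avoiding S.
Proof.
move=> sub; apply/subsetP => f; rewrite !inE => /forallP av; apply/forallP => k.
apply/implyP => /andP[Pk kS]; apply: (implyP (av k)).
by rewrite Pk (subset_trans kS).
Qed.

Lemma cylinder_avoiding (S S' : {set I}) :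
  [disjoint S & S'] -> cylinder S (avoiding S').
Proof.
move=> dis f i q; rewrite !inE => /forallP av iS; apply/forallP => k.
apply/implyP => /andP[Pk kS]; rewrite through_set_coord.
  by apply: (implyP (av k)); rewrite Pk.
apply/negP => /(subsetP kS) iS'.
by move/disjoint_setI0/setP/(_ i): dis; rewrite !inE iS iS'.
Qed.

Hypothesis M_gt0 : (0 < M)%N.
Hypothesis light : forall i,
  \sum_(k | P k && (i \in support (e k))) (2 / M%:R) ^+ #|e k| <= 1 :> R.

(* Each coordinate freed from the constraints at most doubles the count, so
   fixing the coordinates in an edge costs a factor at most [(2 / M) ^ #|e k|]. *)
Lemma card_avoiding_bad (S : {set I}) i k :
  i \notin S ->
  (forall S' : {set I}, S' \subset S -> (#|avoiding S'| <= 2 ^ #|S :\: S'| * #|avoiding S|)%N) ->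
  i \in support (e k) -> support (e k) \subset i |: S ->
  #|[set f in avoiding S | through f (e k)]|%:R <=
    (2 / M%:R) ^+ #|e k| / 2 * #|avoiding S|%:R :> R.
Proof.
move=> iS IH ik kS.
have dis : [disjoint support (e k) & S :\: support (e k)].
  by rewrite -setI_eq0 setDE setICA setICr setI0.
have le1 := card_through (cylinder_avoiding dis).
have le2 := IH _ (subsetDl S (support (e k))).
(* The coordinate [i] of the edge lies outside [S], so at most [#|e k| - 1] coordinates were freed;
   the factor 2 saved gives the [/ 2] in the bound. *)
have le3 : (2 ^ #|S :\: (S :\: support (e k))|.+1 <= 2 ^ #|e k|)%N.
  rewrite leq_exp2l // (leq_trans _ (leq_imset_card fst (e k))) //.
  apply/proper_card/properP; split; first by rewrite setDDr setDv set0U subsetIr.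
  by exists i => //; rewrite !inE (negPf iS) andbF.
have le4 : (#|[set f in avoiding S | through f (e k)]| <=
    #|[set f in avoiding (S :\: support (e k)) | through f (e k)]|)%N.
  apply/subset_leq_card/subsetP => f; rewrite in_set => /andP[fS fk].
  by rewrite in_set fk (subsetP (avoidingS (subsetDl _ _)) _ fS).
rewrite expr_div_n mulrAC ler_pdivlMr // mulrAC ler_pdivlMr; last first.
  by rewrite exprn_gt0 // ltr0n.
rewrite -natrX -natrX -!natrM ler_nat.
apply: leq_trans (leq_mul le3 (leqnn _)); rewrite expnS.
rewrite mulnAC [X in (X <= _)%N]mulnC -mulnA leq_mul2l /= (leq_trans _ le2) // (leq_trans _ le1) //.
by rewrite leq_mul2r le4 orbT.
Qed.

(** A function lost on adding [i] contains an edge through [i]. Summing the preceding bound over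
    these edges, [light] shows that at most half are lost. *)
Lemma card_avoidingU1 (S : {set I}) i :
  i \notin S ->
  (forall S' : {set I}, S' \subset S -> (#|avoiding S'| <= 2 ^ #|S :\: S'| * #|avoiding S|)%N) ->
  (#|avoiding S| <= 2 * #|avoiding (i |: S)|)%N.
Proof.
move=> iS IH.
pose bad k := [set f in avoiding S | through f (e k)].
have le : (#|avoiding S| <= #|avoiding (i |: S)| +
  \sum_(k | [&& P k, i \in support (e k) & support (e k) \subset i |: S]) #|bad k|)%N.
  apply: leq_trans (_ : #|avoiding (i |: S) :|:
    \bigcup_(k | [&& P k, i \in support (e k) & support (e k) \subset i |: S]) bad k| <= _)%N.
    apply/subset_leq_card/subsetP => f fS; rewrite in_setU.
    have [//|] := boolP (f \in avoiding (i |: S)).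
    rewrite !inE => /forallPn[k]; rewrite negb_imply negbK => /andP[/andP[Pk kS] fk].
    apply/bigcupP; exists k; last by rewrite inE fS fk.
    rewrite Pk kS andbT /=; apply/negPn/negP => ik.
    move: fS; rewrite inE => /forallP/(_ k); rewrite Pk fk /= implybF => /negP; apply.
    apply/subsetP => j jk; have := subsetP kS _ jk; rewrite !inE => /orP[/eqP ji|//].
    by move: ik; rewrite -ji jk.
  rewrite (leq_trans (leq_card_setU _ _).1) // leq_add2l.
  elim/big_rec2: _ => [|k m B _ leB]; first by rewrite cards0.
  by rewrite (leq_trans (leq_card_setU _ _).1) // leq_add2l.
have : \sum_(k | [&& P k, i \in support (e k) & support (e k) \subset i |: S])
    #|bad k|%:R <= 2^-1 * #|avoiding S|%:R :> R.
  apply: le_trans (_ : \sum_(k | P k && (i \in support (e k)))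
    (2 / M%:R) ^+ #|e k| / 2 * #|avoiding S|%:R <= _).
    rewrite [X in _ <= X](bigID (fun k => support (e k) \subset i |: S)) /=.
    rewrite -[X in X <= _]addr0 lerD //.
      under [X in _ <= X]eq_bigl do rewrite -andbA.
      by apply: ler_sum => k /and3P[Pk ik kS]; apply: card_avoiding_bad iS IH ik kS.
    by apply: sumr_ge0 => k _; rewrite !mulr_ge0 ?exprn_ge0 ?divr_ge0 ?invr_ge0 ?ler0n.
  by rewrite -!mulr_suml ler_wpM2r ?ler0n // ler_piMl ?invr_ge0 ?ler0n.
rewrite -natr_sum.
move: (\sum_(k | _) _)%N le => s; rewrite -(ler_nat R) -(ler_nat R) natrD natrM.
by lra.
Qed.

Lemma exists_avoiding :
  (forall k, P k -> e k != set0) ->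
  exists f : {ffun I -> 'I_M}, forall k, P k -> ~~ through f (e k).
Proof.
move=> e_neq0.
have count m (S : {set I}) : (#|S| < m)%N -> forall S' : {set I}, S' \subset S ->
    (#|avoiding S'| <= 2 ^ #|S :\: S'| * #|avoiding S|)%N.
  elim: m S => // m IHm S Sm S' S'S.
  have [->|neqS] := eqVneq S' S; first by rewrite setDv cards0 mul1n.
  have /properP[_ [i iS iS']] : S' \proper S by rewrite properEneq neqS.
  have cardS := cardsD1 i S; rewrite iS in cardS.
  have Tm : (#|S :\ i| < m)%N by move: Sm; rewrite cardS.
  have := card_avoidingU1 (negbT (setD11 i S)) (IHm _ Tm); rewrite setD1K // => leT.
  have S'T : S' \subset S :\ i by rewrite subsetD1 S'S.
  apply: leq_trans (IHm _ Tm _ S'T) _.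
  have -> : S :\: S' = i |: ((S :\ i) :\: S').
    apply/setP => j; rewrite !inE; have [->|//] := eqVneq j i.
    by rewrite iS iS'.
  by rewrite cardsU1 !inE eqxx iS' /= add1n expnSr -mulnA leq_mul2l leT orbT.
(* With no constraints on the left, that side counts all functions and is positive, which forces the
   fully constrained count to be positive. *)
have := count _ [set: I] (ltnSn _) set0 (sub0set _).
have -> : avoiding set0 = setT.
  apply/setP => f; rewrite !inE; apply/forallP => k; apply/implyP => /andP[Pk].
  by rewrite subset0 imset_eq0 (negPf (e_neq0 _ Pk)).
have: (0 < #|[set: {ffun I -> 'I_M}]|)%N.
  by apply/card_gt0P; exists [ffun=> Ordinal M_gt0].
move=> gt0 /(leq_trans gt0); rewrite muln_gt0 => /andP[_ /card_gt0P[f]].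
rewrite inE => /forallP av; exists f => k Pk.
by have /implyP := av k; rewrite Pk subsetT; apply.
Qed.
End Transversal.

(** * Sidon transversals *)

Section SidonTransversal.
Variable R : realFieldType.
Variables (I : finType) (M D : nat) (val : I * 'I_M -> nat).
Let point := (I * 'I_M)%type.
Let pair := (point * point)%type.
Hypothesis val_inj : injective val.
Hypothesis val_gt0 : forall x, (0 < val x)%N.
Hypothesis divisors_le : forall x y, (size (divisors (val x * val y)) <= D)%N.

Definition val_prod (u : pair) := (val u.1 * val u.2)%N.

(** The first value of [v] is a divisor of the product and determines the second value; injectivity
    of [val] then recovers [v]. *)
Lemma card_val_prod (u : pair) : (#|[pred v | val_prod u == val_prod v]| <= D)%N.
Proof.
apply: leq_trans (divisors_le u.1 u.2).
rewrite cardE -(size_map (fun v : pair => val v.1)).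
apply: uniq_leq_size => [|_ /mapP[v + ->]]; last first.
  rewrite mem_enum inE /val_prod => /eqP uv.
  by rewrite -dvdn_divisors ?muln_gt0 ?val_gt0 // uv dvdn_mulr.
rewrite map_inj_in_uniq ?enum_uniq // => v v'; rewrite !mem_enum !inE.
move=> /eqP -> /eqP; rewrite /val_prod; case: v v' => [a b] [a' b'] /= + /val_inj aa'.
by rewrite aa' => /eqP; rewrite eqn_pmul2l // => /eqP/val_inj ->.
Qed.

Lemma card_solutions_left (S : {pred pair}) :
  (#|[pred k : pair * pair | (k.1 \in S) && (val_prod k.1 == val_prod k.2)]| <= #|S| * D)%N.
Proof.
rewrite -sum1_card.
rewrite -(pair_big_dep (mem S) (fun u v => val_prod u == val_prod v) (fun _ _ => 1%N)) /=.
rewrite -sum_nat_const; apply: leq_sum => u _.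
by rewrite sum1_card card_val_prod.
Qed.

Lemma card_solutions_right (S : {pred pair}) :
  (#|[pred k : pair * pair | (k.2 \in S) && (val_prod k.1 == val_prod k.2)]| <= #|S| * D)%N.
Proof.
apply: leq_trans (card_solutions_left S).
rewrite -!sum1_card (reindex_inj (can_inj (@swap_pairK _ _))) /=.
by under eq_bigl do rewrite inE /= eq_sym.
Qed.

Let edge (k : pair * pair) := k.1.1 |: (k.1.2 |: (k.2.1 |: [set k.2.2])).

(** A point shared by both sides could be cancelled, making the solution trivial. A repeated point
    within one side is allowed. *)
Definition nontrivial (k : pair * pair) :=
  (val_prod k.1 == val_prod k.2) &&
  [&& k.1.1 != k.2.1, k.1.1 != k.2.2, k.1.2 != k.2.1 & k.1.2 != k.2.2].

(** Points can coincide only within a side, and not within both: equal squares would have equal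
    roots. *)
Lemma card_edge k : nontrivial k ->
  #|edge k| = (if (k.1.1 == k.1.2) || (k.2.1 == k.2.2) then 3 else 4)%N.
Proof.
case: k => [[a b] [c d]] /andP[/= eq_prod /and4P[ac ad bc bd]] /=.
move: eq_prod; rewrite /edge /= /val_prod /= => eq_prod; rewrite !cardsU1 cards1 !inE.
rewrite (negPf ac) (negPf ad) (negPf bc) (negPf bd) /=.
have [ab|ab] := eqVneq a b; have [cd|cd] //= := eqVneq c d.
move: eq_prod; rewrite -ab -cd !mulnn eqn_exp2r // => /eqP/val_inj/eqP.
by rewrite (negPf ac).
Qed.

Hypothesis D_gt0 : (0 < D)%N.
Hypothesis M_large : (80 * D * #|I| <= M ^ 2)%N.

Let w : R := 2 / M%:R.

(** Source of the constant 80: at most [4 * D * #|I| * M ^ 2] solutions have a point over [i], of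
    weight [16 / M ^ 4] each if the points are distinct; at most [2 * D * #|I| * M] solutions, over
    any coordinates, repeat a point, with weight [8 / M ^ 3]. *)
Lemma light_edges i :
  \sum_(k | nontrivial k && (i \in support (edge k))) w ^+ #|edge k| <= 1.
Proof.
have I0 : (0 < #|I|)%N by apply/card_gt0P; exists i.
have M2 : (2 <= M)%N by nia.
have M0 : 0 < M%:R :> R by rewrite ltr0n; lia.
have w0 : 0 <= w by rewrite divr_ge0.
have w1 : w <= 1 by rewrite ler_pdivrMr // mul1r ler_nat.
pose S1 := [pred u : pair | u.1.1 == i]; pose S2 := [pred u : pair | u.2.1 == i].
pose Sd := [pred u : pair | u.1 == u.2].
pose L (S : {pred pair}) (k : pair * pair) := (k.1 \in S) && (val_prod k.1 == val_prod k.2).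
pose Q (S : {pred pair}) (k : pair * pair) := (k.2 \in S) && (val_prod k.1 == val_prod k.2).
have pointwise k : nontrivial k && (i \in support (edge k)) ->
    w ^+ #|edge k| <= w ^+ 4 * (L S1 k + L S2 k + Q S1 k + Q S2 k)%:R
      + w ^+ 3 * (L Sd k + Q Sd k)%:R.
  move=> /andP[nt /imsetP[x xk ix]]; rewrite (card_edge nt) {}/L {}/Q.
  case/andP: nt => -> _; rewrite !andbT !inE.
  case: orP => [diag|_].
    rewrite -[X in X <= _]add0r; apply: lerD; first by rewrite mulr_ge0 ?exprn_ge0.
    rewrite ler_peMr ?exprn_ge0 //.
    by rewrite ler1n; case: diag => ->; rewrite ?addnS.
  rewrite -[X in X <= _]addr0; apply: lerD; last by rewrite mulr_ge0 ?exprn_ge0.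
  rewrite ler_peMr ?exprn_ge0 //.
  rewrite ler1n; move: xk; rewrite !inE ix -?orbA.
  by case/or4P => /eqP ->; rewrite eqxx ?addnS ?addSn.
have cardS1 : #|S1| = (M * (#|I| * M))%N.
  pose A := [pred x : point | x.1 == i].
  have -> : #|S1| = #|predX A {: point}|.
    by apply: eq_card => -[x y]; rewrite !inE andbT.
  rewrite cardX cardT -cardE card_prod card_ord; congr (_ * _)%N.
  have -> : #|A| = #|predX (pred1 i) {: 'I_M}|.
    by apply: eq_card => -[x y]; rewrite !inE andbT.
  by rewrite cardX card1 card_ord mul1n.
have cardS2 : #|S2| = (M * (#|I| * M))%N.
  rewrite -cardS1 -!sum1_card (reindex_inj (can_inj (@swap_pairK _ _))) /=.
  exact: eq_bigl.
have cardSd : #|Sd| = (#|I| * M)%N.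
  rewrite -[M in RHS]card_ord -card_prod -cardsT -(card_imset _ (_ : injective (fun x => (x, x)))).
    apply: eq_card => -[x y]; rewrite !inE /=; apply/eqP/imsetP => [->|[z _ [-> ->]]//].
    by exists y.
  by move=> x y [].
apply: le_trans (ler_sum _ pointwise) _.
apply: le_trans (_ : \sum_k (w ^+ 4 * (L S1 k + L S2 k + Q S1 k + Q S2 k)%:R
      + w ^+ 3 * (L Sd k + Q Sd k)%:R) <= _).
  rewrite [X in _ <= X](bigID (fun k => nontrivial k && (i \in support (edge k)))) /=.
  rewrite lerDl sumr_ge0 // => k _.
  by rewrite addr_ge0 // mulr_ge0 ?exprn_ge0.
rewrite big_split /= -!mulr_sumr -!natr_sum !big_split /=.
have sum_bool (B : pred (pair * pair)) : (\sum_k B k)%N = #|[pred k | B k]|.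
  by rewrite -sum1_card [RHS]big_mkcond; apply: eq_bigr => k _; rewrite inE; case: (B k).
have leL S : (\sum_k L S k <= #|S| * D)%N by rewrite sum_bool card_solutions_left.
have leQ S : (\sum_k Q S k <= #|S| * D)%N by rewrite sum_bool card_solutions_right.
apply: le_trans (_ : w ^+ 4 * (4 * (M * (#|I| * M) * D))%:R + w ^+ 3 * (2 * (#|I| * M * D))%:R <= _).
  apply: lerD; apply: ler_wpM2l; rewrite ?exprn_ge0 // ler_nat.
    apply: leq_trans (leq_add (leq_add (leq_add (leL _) (leL _)) (leQ _)) (leQ _)) _.
    by rewrite cardS1 cardS2; lia.
  by apply: leq_trans (leq_add (leL _) (leQ _)) _; rewrite cardSd; lia.
rewrite !natrM /w; move: M_large; rewrite -(ler_nat R) !natrM -expr2.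
move: (#|I|%:R) (D%:R) M%:R M0 => n d m m0 large.
have -> : (2 / m) ^+ 4 * (4 * (m * (n * m) * d)) + (2 / m) ^+ 3 * (2 * (n * m * d)) =
    80 * d * n / m ^+ 2 by field; rewrite gt_eqF.
by rewrite ler_pdivrMr ?exprn_gt0 // mul1r.
Qed.

Lemma exists_sidon_transversal : (0 < M)%N ->
  exists f : {ffun I -> 'I_M}, forall i j k l,
    (val (i, f i) * val (j, f j) = val (k, f k) * val (l, f l))%N ->
    (i = k /\ j = l) \/ (i = l /\ j = k).
Proof.
move=> M_gt0.
have [|f fP] := exists_avoiding M_gt0 light_edges.
  by move=> k _; apply/set0Pn; exists k.1.1; rewrite !inE eqxx.
exists f => i j k l eq_prod.
have cancel i' j' k' : (val (i', f i') * val (j', f j') = val (i', f i') * val (k', f k'))%N -> j' = k'.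
  by move/eqP; rewrite eqn_pmul2l // => /eqP/val_inj[].
have [ik|ik] := eqVneq i k; first by left; subst k; split=> //; apply: (cancel i).
have [il|il] := eqVneq i l.
  by right; subst l; split=> //; apply: (cancel i); rewrite eq_prod mulnC.
have [jk|jk] := eqVneq j k.
  right; subst k; split=> //; apply: (cancel j).
  by rewrite mulnC eq_prod.
have [jl|jl] := eqVneq j l.
  by left; subst l; split=> //; apply: (cancel j); rewrite mulnC eq_prod mulnC.
have neq x y : x != y -> (x, f x) != (y, f y) :> point by apply: contraNneq => -[->].
have := fP (((i, f i), (j, f j)), ((k, f k), (l, f l))).
rewrite /nontrivial /val_prod /= eq_prod eqxx !neq // => /(_ isT)/negP[].
by apply/forall_inP => x; rewrite !inE => /or4P[] /eqP ->.
Qed.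
End SidonTransversal.

(** * The divisor bound *)

Section DivisorBound.
Local Open Scope nat_scope.

(** A divisor [d] of [a * b] splits as [gcdn d a] times [d %/ gcdn d a], and the cofactor divides
    [b]. *)
Lemma size_divisorsM a b : 0 < a -> 0 < b ->
  size (divisors (a * b)) <= size (divisors a) * size (divisors b).
Proof.
move=> a0 b0; rewrite -(size_allpairs muln).
apply: uniq_leq_size (divisors_uniq _) _ => d.
rewrite -dvdn_divisors ?muln_gt0 ?a0 // => d_ab.
have d0 : 0 < d by rewrite (dvdn_gt0 _ d_ab) // muln_gt0 a0.
have g0 : 0 < gcdn d a by rewrite gcdn_gt0 d0.
apply/allpairsP; exists (gcdn d a, d %/ gcdn d a) => /=; split.
- by rewrite -dvdn_divisors // dvdn_gcdr.
- rewrite -dvdn_divisors // -(@Gauss_dvdr _ (a %/ gcdn d a)).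
    by rewrite -(dvdn_pmul2r g0) mulnAC !divnK ?dvdn_gcdl ?dvdn_gcdr.
  by rewrite /coprime -(eqn_pmul2r g0) muln_gcdl !divnK ?dvdn_gcdl ?dvdn_gcdr ?mul1n.
- by rewrite mulnC divnK // dvdn_gcdl.
Qed.

Lemma size_divisors_pfactor p e : prime p -> size (divisors (p ^ e)) <= e.+1.
Proof.
move=> p_pr; rewrite -[leqRHS](size_iota 0) -[leqRHS](size_map (expn p)).
apply: uniq_leq_size (divisors_uniq _) _ => d.
rewrite -dvdn_divisors ?expn_gt0 ?prime_gt0 // => /dvdn_pfactor[] // f le_fe ->.
by rewrite map_f // mem_iota.
Qed.

(** The power is at most (e + 1)...(e + k), which is k! times a binomial coefficient bounded by 2^(e
    + k). Serves both for prime exponents and for the logarithm of n. *)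
Lemma expSn_leq_exp2 k e : e.+1 ^ k <= k`! * 2 ^ k * 2 ^ e.
Proof.
have bin_le n m : 'C(n, m) <= 2 ^ n.
  elim: n m => [|n IHn] [|m]; rewrite ?bin0 ?expn_gt0 ?bin0n //.
  by rewrite binS expnS mul2n -addnn leq_add.
apply: (@leq_trans ((e + k) ^_ k)); last first.
  by rewrite -bin_ffact mulnC -mulnA -expnD addnC leq_mul2l addnC bin_le orbT.
elim: k => // k IHk; rewrite addnS ffactSS expnS leq_mul //.
by rewrite ltnS leq_addr.
Qed.

(** Removing a prime factor divides [m] by at least [2 ^ k] and the number of divisors by at most
    2. *)
Lemma rough_divisors_bound k m : 0 < m ->
  (forall p, prime p -> p %| m -> 2 ^ k <= p) -> size (divisors m) ^ k <= m.
Proof.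
elim/ltn_ind: m => m IHm m0 rough.
have [m1|m1|->] := ltngtP m 1; last by rewrite exp1n.
  by case: m m0 m1 {IHm rough}.
have p_pr := pdiv_prime m1; set p := pdiv m in p_pr.
have p_m : p %| m by apply: pdiv_dvd.
have p0 := prime_gt0 p_pr.
have d0 : 0 < m %/ p by rewrite divn_gt0 // dvdn_leq.
have := size_divisorsM d0 p0; rewrite divnK // => le_m.
rewrite -[leqRHS](divnK p_m).
apply: (@leq_trans ((size (divisors (m %/ p)) * 2) ^ k)).
  case: k {IHm rough} => // k; rewrite leq_exp2r // (leq_trans le_m) // leq_mul2l.
  by have := size_divisors_pfactor 1 p_pr; rewrite expn1 => ->; rewrite orbT.
rewrite expnMn leq_mul ?rough //.
apply: IHm => // [|q q_pr q_m]; first by rewrite ltn_Pdiv // prime_gt1.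
by rewrite rough // (dvdn_trans q_m) // dvdn_div.
Qed.

(* A prime [q < 2 ^ k] contributes a factor [e.+1 ^ k <= C * 2 ^ e <= C * q ^ e];
   [s] bounds the number of these primes. *)
Lemma divisors_bound k :
  exists C, forall m, 0 < m -> size (divisors m) ^ k <= C * m.
Proof.
have arith x y z : x <= y + z.+1 -> y != x - z.+1 -> x <= y + z by lia.
pose C := k`! * 2 ^ k; exists (C ^ 2 ^ k) => m m0.
(* Small primes are removed in increasing order: at stage [s] only primes from [2 ^ k - s] on may
   divide [m]. This is vacuous at the start, and at [s = 0] the rough case applies. *)
have : forall p, prime p -> p %| m -> 2 ^ k <= p + 2 ^ k by move=> p _ _; rewrite leq_addl.
have C0 : 0 < C by rewrite muln_gt0 fact_gt0 expn_gt0.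
move: {2 3}(2 ^ k) => s; elim: s m m0 => [|s IHs] m m0 rough.
  by rewrite mul1n rough_divisors_bound // => p /rough/[apply]; rewrite addn0.
set q := 2 ^ k - s.+1.
have rough' m' : m' %| m -> ~~ (prime q && (q %| m')) ->
    forall p, prime p -> p %| m' -> 2 ^ k <= p + s.
  move=> m'm qm' p p_pr pm'; have pq : p != q by apply: contraNneq qm' => <-; rewrite p_pr.
  exact: arith (rough p p_pr (dvdn_trans pm' m'm)) pq.
have [q_m|] := boolP (prime q && (q %| m)); last first.
  move=> /(rough' m (dvdnn m)) /(IHs _ m0) /leq_trans -> //.
  by rewrite leq_mul2r leq_pexp2l ?orbT.
case/andP: q_m => q_pr q_m.
have [m' cop def_m] := pfactor_coprime q_pr m0; set e := logn q m in def_m.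
have m'0 : 0 < m' by move: m0; rewrite def_m muln_gt0 => /andP[].
have qe0 : 0 < q ^ e by rewrite expn_gt0 prime_gt0.
have le_m' : size (divisors m') ^ k <= C ^ s * m'.
  apply: IHs => //; apply: rough'; first by rewrite def_m dvdn_mulr.
  by rewrite q_pr -prime_coprime.
have le_e : size (divisors (q ^ e)) ^ k <= C * q ^ e.
  apply: leq_trans (_ : e.+1 ^ k <= _).
    by case: (k) => // k'; rewrite leq_exp2r // size_divisors_pfactor.
  apply: leq_trans (expSn_leq_exp2 k e) _.
  rewrite leq_mul2l; apply/orP; right.
  by case: (e) => // e'; rewrite leq_exp2r // prime_gt1.
rewrite def_m; apply: (@leq_trans ((size (divisors m') * size (divisors (q ^ e))) ^ k)).
  by case: (k) => // k'; rewrite leq_exp2r // size_divisorsM.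
by rewrite expnMn expnSr mulnACA leq_mul.
Qed.
End DivisorBound.

(** * Selecting primes *)

Section Selection.
Variable R : realFieldType.
Variables (T U : eqType) (kill : U -> T -> bool).

Definition kill_rate (Cs : seq (seq U)) (a : T) : R :=
  \sum_(C <- Cs) (count (kill^~ a) C)%:R / (size C)%:R.

Lemma kill_rate_ge0 Cs a : 0 <= kill_rate Cs a.
Proof. by apply: sumr_ge0 => C _; rewrite divr_ge0. Qed.

Definition survivors p B := [seq a <- B | ~~ kill p a].

(** One step of the method of conditional expectations, with [phi] the kill rate of the lists still
    to come. A killed element leaves the product, thus counts as a factor 1. As [p] kills at most
    one element of [B], every term on the left is accounted for when the right side is expanded. *)
Lemma sum_prod_survivors (phi : T -> R) (C : seq U) (B : seq T) :
  (forall a, 0 <= phi a) ->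
  (forall p, p \in C -> count (kill p) B <= 1)%N ->
  C != [::] ->
  \sum_(p <- C) \prod_(a <- survivors p B) phi a <=
    (size C)%:R * \prod_(a <- B) ((count (kill^~ a) C)%:R / (size C)%:R + phi a).
Proof.
move=> phi_ge0 + C_neq0.
have C0 : 0 < (size C)%:R :> R by rewrite ltr0n lt0n size_eq0.
elim: B => [|a B IHB] kill1.
  rewrite big_nil mulr1 (eq_bigr (fun=> 1)); last by move=> p _; rewrite big_nil.
  by rewrite big_const_seq count_predT iter_addr_0.
rewrite big_cons (bigID (fun p => kill p a)) /=.
have killB p : p \in C -> (count (kill p) B <= 1)%N.
  by move=> /kill1 /=; apply: leq_trans; rewrite leq_addl.
set Y := \prod_(b <- B) _.
have le1 : \sum_(p <- C | kill p a) \prod_(b <- survivors p (a :: B)) phi b <=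
    (count (kill^~ a) C)%:R * Y.
  rewrite -sum1_count natr_sum mulr_suml big_seq_cond [X in _ <= X]big_seq_cond.
  apply: ler_sum => p /andP[pC pa]; rewrite mul1r /survivors /= pa /=.
  have /eqP : count (kill p) B = 0%N by have /= := kill1 p pC; rewrite pa; case: count.
  rewrite -leqn0 leqNgt -has_count => noB.
  rewrite (_ : [seq _ <- B | _] = B); last first.
    by apply/all_filterP; rewrite all_predC.
  by apply: ler_prod => b _; rewrite phi_ge0 /= lerDr divr_ge0.
have le2 : \sum_(p <- C | ~~ kill p a) \prod_(b <- survivors p (a :: B)) phi b <=
    phi a * ((size C)%:R * Y).
  apply: le_trans (ler_wpM2l (phi_ge0 a) (IHB killB)).
  rewrite mulr_sumr [X in _ <= X](bigID (fun p => kill p a)) /= -[X in X <= _]add0r.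
  apply: lerD.
    by apply: sumr_ge0 => p _; rewrite mulr_ge0 // prodr_ge0.
  rewrite le_eqVlt; apply/orP; left; apply/eqP/eq_bigr => p pa.
  by rewrite /survivors /= pa /= big_cons.
apply: le_trans (lerD le1 le2) _.
rewrite le_eqVlt; apply/orP; left; apply/eqP; rewrite -/Y.
by field; rewrite gt_eqF.
Qed.

(* Choosing [p] uniformly in each [C] independently, [kill_rate Cs a] bounds the
   probability that [a] is killed; the choices are made one at a time so that the
   expected number of blocks all of whose elements are killed stays below [1]. *)
Lemma exists_selection (Cs : seq (seq U)) (Bs : seq (seq T)) :
  (forall C, C \in Cs -> C != [::]) ->
  (forall C p B, C \in Cs -> p \in C -> B \in Bs -> count (kill p) B <= 1)%N ->
  \sum_(B <- Bs) \prod_(a <- B) kill_rate Cs a < 1 ->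
  exists sel : seq U,
    [/\ forall C, C \in Cs -> exists2 p, p \in sel & p \in C,
        forall p, p \in sel -> exists2 C, C \in Cs & p \in C &
        forall B, B \in Bs -> exists2 a, a \in B & forall p, p \in sel -> ~~ kill p a].
Proof.
elim: Cs Bs => [|C Cs IHCs] Bs Cs_neq0 kill1 lt1.
  exists [::]; split => // B BBs.
  (* An empty block, fully killed, would contribute the empty product 1 to the sum. *)
  case: B BBs => [|a B] BBs; last by exists a; rewrite ?mem_head.
  move: lt1; rewrite (big_rem _ BBs) /= big_nil gtrDl ltNge => /negP[].
  by apply: sumr_ge0 => B _; apply: prodr_ge0 => a _; apply: kill_rate_ge0.
have C_neq0 : C != [::] by apply: Cs_neq0; rewrite mem_head.
have C0 : 0 < (size C)%:R :> R by rewrite ltr0n lt0n size_eq0.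
have [/hasP[p pC ltp]|/hasPn geC] := boolP (has (fun p =>
    \sum_(B <- map (survivors p) Bs) \prod_(a <- B) kill_rate Cs a < 1) C).
  have [||sel [selC selCs selB]] := IHCs (map (survivors p) Bs) _ _ ltp.
  - by move=> C' C'Cs; apply: Cs_neq0; rewrite in_cons C'Cs orbT.
  - move=> C' q _ C'Cs qC' /mapP[B BBs ->].
    have /leq_trans -> // : (count (kill q) (survivors p B) <= count (kill q) B)%N.
      by rewrite count_filter; apply: sub_count => a /andP[].
    by apply: kill1 qC' BBs; rewrite in_cons C'Cs orbT.
  exists (p :: sel); split.
  - move=> C'; rewrite in_cons => /orP[/eqP ->|/selC[q qsel qC']].
      by exists p; rewrite ?mem_head.
    by exists q; rewrite // in_cons qsel orbT.
  - move=> q; rewrite in_cons => /orP[/eqP ->|/selCs[C' C'Cs qC']].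
      by exists C; rewrite ?mem_head.
    by exists C'; rewrite // in_cons C'Cs orbT.
  - move=> B BBs; have [|a] := selB (survivors p B); first exact: map_f.
    rewrite mem_filter => /andP[pa aB] ksel; exists a => // q.
    by rewrite in_cons => /orP[/eqP ->|/ksel].
(* If no [p] in [C] kept the sum below 1, averaging over [C] would contradict the assumption. *)
suff : (size C)%:R <= (size C)%:R * \sum_(B <- Bs) \prod_(a <- B) kill_rate (C :: Cs) a.
  by rewrite ler_pMr // leNgt lt1.
apply: le_trans (_ : \sum_(p <- C) \sum_(B <- Bs) \prod_(a <- survivors p B) kill_rate Cs a <= _).
  have -> : (size C)%:R = \sum_(p <- C) 1 :> R.
    by rewrite big_const_seq count_predT iter_addr_0.
  rewrite big_seq [X in _ <= X]big_seq; apply: ler_sum => p pC.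
  by have := geC p pC; rewrite big_map -leNgt.
rewrite exchange_big mulr_sumr /= big_seq [X in _ <= X]big_seq; apply: ler_sum => B BBs.
under [X in _ <= _ * X]eq_bigr do rewrite /kill_rate big_cons -/(kill_rate _ _).
apply: sum_prod_survivors => //; first exact: kill_rate_ge0.
by move=> p pC; apply: kill1 pC BBs; rewrite mem_head.
Qed.
End Selection.

(** * Sidon sets meeting all blocks *)

Section Blocks.
Local Open Scope nat_scope.

Lemma count_dvdn_iota p m b : b <= p -> count (dvdn p) (iota m b) <= 1.
Proof.
elim: b m => // b IHb m lt_bp /=.
have [pm|_] := boolP (p %| m); last exact: IHb (ltnW lt_bp).
rewrite add1n ltnS leqNgt -has_count; apply/hasPn => x; rewrite mem_iota => x_m.
have -> : x = m + (x - m) by lia.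
by rewrite dvdn_addr // gtnNdvd //; lia.
Qed.

Definition sidon (A : nat -> Prop) := forall a b c d, A a -> A b -> A c -> A d ->
  a * b = c * d -> (a = c /\ b = d) \/ (a = d /\ b = c).

(** A prime of [P] on one side divides a factor on the other side, hence equals it, since it divides
    no element of [E] and no other prime of [P]. Cancelling it leaves a trivial solution. *)
Lemma sidon_primesU (P : seq nat) (E : nat -> Prop) :
  (forall p, p \in P -> prime p) -> (forall a, E a -> 0 < a) ->
  (forall a p, E a -> p \in P -> ~~ (p %| a)) -> sidon E ->
  sidon (fun a => a \in P \/ E a).
Proof.
move=> P_pr E0 PE sidE.
have gt0 a : a \in P \/ E a -> 0 < a by case=> [/P_pr/prime_gt0|/E0].
have dvdP p a : p \in P -> a \in P \/ E a -> p %| a -> p = a.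
  by move=> pP [aP|/PE/(_ pP)/negPf ->//]; rewrite dvdn_prime2 ?P_pr // => /eqP.
have primeP p b c d : p \in P -> b \in P \/ E b -> c \in P \/ E c -> d \in P \/ E d ->
    p * b = c * d -> (p = c /\ b = d) \/ (p = d /\ b = c).
  move=> pP bA cA dA eq_prod; have p_gt0 := prime_gt0 (P_pr p pP).
  have : p %| c * d by rewrite -eq_prod dvdn_mulr.
  rewrite Euclid_dvdM ?P_pr // => /orP[] /dvdP pE; [left|right].
    have pc := pE pP cA; split=> //; apply/eqP; rewrite -(eqn_pmul2l p_gt0).
    by rewrite eq_prod -pc.
  have pd := pE pP dA; split=> //; apply/eqP; rewrite -(eqn_pmul2l p_gt0).
  by rewrite eq_prod -pd mulnC.
move=> a b c d [aP|aE] bA cA dA eq_prod; first exact: primeP.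
have aA : a \in P \/ E a by right.
case: (bA) => [bP|bE].
  by have := primeP b a c d bP aA cA dA; rewrite mulnC => /(_ eq_prod); tauto.
case: (cA) => [cP|cE].
  by have [[-> ->]|[-> ->]] := primeP c d a b cP dA aA bA (esym eq_prod); tauto.
case: (dA) => [dP|dE]; last exact: sidE.
have := primeP d c a b dP cA aA bA; rewrite mulnC eq_prod => /(_ erefl).
by case=> -[-> ->]; tauto.
Qed.

Lemma leq_expn_primes_dvd H (s : seq nat) a :
  0 < a -> uniq s -> (forall p, p \in s -> [/\ prime p, H <= p & p %| a]) ->
  H ^ size s <= a.
Proof.
elim: s a => [|p s IHs] a a0 //= /andP[ps s_uniq] sP.
have [p_pr Hp pa] := sP p (mem_head _ _).
rewrite -(divnK pa) expnSr leq_mul //; apply: IHs => // [|q qs].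
  by rewrite divn_gt0 ?prime_gt0 // dvdn_leq.
have [|q_pr Hq qa] := sP q; first by rewrite in_cons qs orbT.
split=> //; rewrite -(@Gauss_dvdl _ _ p) ?divnK //.
rewrite prime_coprime // dvdn_prime2 //.
by apply: contraNneq ps => <-.
Qed.

Variables (R : realFieldType) (n H t b D r : nat).
Hypothesis t_gt0 : 0 < t.
(* Hence at most [t] primes above [H] divide a given positive integer up to [n]. *)
Hypothesis n_lt_expH : n < H ^ t.+1.
Hypothesis n_lt_exp2 : n < 2 ^ b.
Hypothesis r_le : r.+1 * H <= n.
Let M := H %/ b.
Hypothesis M_gt0 : 0 < M.
Hypothesis divisors_le : forall m, 0 < m <= n ^ 2 -> size (divisors m) <= D.

Definition block_primes h j := [seq p <- iota (j * h).+1 h | prime p].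
Definition poor h k j := size (block_primes h j) < k.
(** Block 0 is omitted so that all candidate primes exceed [H]; [r_le] keeps the other blocks inside
    [1, n]. *)
Let bad := [seq j <- iota 1 r | poor H (2 * t) j].
Hypothesis bad_small : 80 * D * size bad <= M ^ 2.

(** Exactly [2 * t] primes are kept per rich block: when at most [t] candidates divide an integer,
    its kill rate is then at most 1/2. *)
Let cands := [seq take (2 * t) (block_primes H j) | j <- iota 1 r & ~~ poor H (2 * t) j].
Let cell j c := iota (j * H + c * b).+1 b.

Lemma cand_primeP C p : C \in cands -> p \in C -> [/\ prime p, H < p & p <= n].
Proof.
case/mapP=> j; rewrite mem_filter mem_iota => /andP[_ jr] -> /mem_take.
by rewrite mem_filter mem_iota => /andP[-> pj]; split => //; nia.
Qed.

Lemma size_cand C : C \in cands -> size C = 2 * t.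
Proof.
case/mapP=> j; rewrite mem_filter /poor -leqNgt => /andP[sz _] ->.
by rewrite size_takel.
Qed.

(** The blocks being disjoint, the candidates dividing [a] are distinct primes above [H]; [t.+1] of
    them would have a product exceeding [n]. *)
Lemma sum_count_cands a : 0 < a <= n -> \sum_(C <- cands) count (dvdn^~ a) C <= t.
Proof.
case/andP=> a0 an.
pose s := [seq p <- iota H.+1 (r * H) | prime p & p %| a].
apply: (@leq_trans (size s)).
  rewrite size_filter big_map.
  apply: leq_trans (_ : \sum_(j <- iota 1 r) count (fun p => prime p && (p %| a)) (iota (j * H).+1 H) <= _).
    rewrite big_filter [leqRHS](bigID (fun j => ~~ poor H (2 * t) j)) /=.
    apply: leq_trans (leq_addr _ _); apply: leq_sum => j _.
    apply: leq_trans (_ : count (dvdn^~ a) (block_primes H j) <= _).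
      by rewrite -[X in _ <= count _ X](cat_take_drop (2 * t)) count_cat leq_addr.
    by rewrite count_filter; apply: sub_count => p /andP[-> ->].
  elim: (r) => [|r' IHr]; first by rewrite big_nil.
  have -> : iota 1 r'.+1 = rcons (iota 1 r') r'.+1 by rewrite -cats1 -[r'.+1]addn1 iotaD add1n addn1.
  have -> : iota H.+1 (r'.+1 * H) = iota H.+1 (r' * H) ++ iota (r'.+1 * H).+1 H.
    by rewrite mulSn addnC iotaD addSn [H + _]addnC.
  by rewrite big_rcons /= count_cat leq_add.
rewrite -ltnS -(@ltn_exp2l H) //; last first.
  have := leq_ltn_trans (leq_trans a0 an) n_lt_expH.
  by case: (H) => [|[|//]]; rewrite ?exp0n ?exp1n.
apply: leq_ltn_trans n_lt_expH; apply: leq_trans an.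
apply: leq_expn_primes_dvd => // [|p]; first by rewrite filter_uniq ?iota_uniq.
by rewrite mem_filter mem_iota => /andP[/andP[p_pr pa] /andP[Hp _]]; split => //; apply: ltnW.
Qed.

Lemma kill_rate_cands a : 0 < a <= n -> (kill_rate R dvdn cands a <= 2^-1)%R.
Proof.
move=> an; rewrite /kill_rate.
have -> : (\sum_(C <- cands) (count (dvdn^~ a) C)%:R / (size C)%:R =
    (\sum_(C <- cands) count (dvdn^~ a) C)%:R / (2 * t)%:R :> R)%R.
  rewrite natr_sum mulr_suml big_seq [RHS]big_seq; apply: eq_bigr => C /size_cand ->.
  by [].
rewrite ler_pdivrMr ?ltr0n ?muln_gt0 // natrM mulKf ?pnatr_eq0 //.
by rewrite ler_nat sum_count_cands.
Qed.

(** Blocks start at [j * H + 1], so quotient and remainder of the predecessor recover block and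
    cell; hence different cells give different integers. *)
Lemma mem_cell j c a : 0 < j <= r -> c < M -> a \in cell j c ->
  [/\ j * H < a <= j.+1 * H, 0 < a <= n & (a.-1 %/ H = j) /\ (a.-1 %% H %/ b = c)].
Proof.
move=> jr cM; rewrite mem_iota => a_cell.
have Mb : M * b <= H by apply: leq_divM.
have cb : c.+1 * b <= M * b by rewrite leq_mul2r cM orbT.
have b0 : 0 < b by case: (b) a_cell => //; lia.
have lt_H : c * b + (a.-1 - (j * H + c * b)) < H by move: cb; rewrite mulSn; lia.
have def_a : a.-1 = j * H + (c * b + (a.-1 - (j * H + c * b))) by lia.
have aj : a <= j.+1 * H by rewrite mulSn; lia.
split; first by rewrite aj andbT; lia.
  have : j.+1 * H <= r.+1 * H by rewrite leq_mul2r; lia.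
  by lia.
split; first by rewrite def_a divnMDl ?divn_small ?addn0 //; lia.
by rewrite def_a modnMDl modn_small // divnMDl // divn_small ?addn0 //; lia.
Qed.

Lemma exists_prime_selection : exists sel : seq nat,
  [/\ forall j, 0 < j <= r -> ~~ poor H (2 * t) j ->
        exists2 p, p \in sel & j * H < p <= j.+1 * H,
      forall p, p \in sel -> prime p && (p <= n) &
      forall j c, 0 < j <= r -> c < M ->
        exists2 a, a \in cell j c & all (fun p => ~~ (p %| a)) sel].
Proof.
have := @exists_selection R _ _ dvdn cands [seq cell j c | j <- iota 1 r, c <- iota 0 M].
case=> [C /size_cand sC|C p B CC pC|| sel [selC selP selB]].
- by rewrite -size_eq0 sC muln_eq0 negb_or -!lt0n t_gt0.
- case/allpairsP=> -[j c] [_ _ ->]; apply: count_dvdn_iota.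
  have [_ Hp _] := cand_primeP CC pC; apply: leq_trans (ltnW Hp).
  by apply: leq_trans (leq_divM H b); rewrite leq_pmull.
(* Union bound: each of the [r * M <= n] cells is wholly killed with probability at most
   [2^-1 ^+ b], and [n < 2 ^ b]. *)
- apply: (@le_lt_trans _ _ (\sum_(B <- [seq cell j c | j <- iota 1 r, c <- iota 0 M]) 2^-1 ^+ b : R)%R).
    rewrite big_seq [X in (_ <= X)%R]big_seq; apply: ler_sum => B.
    case/allpairsP=> -[j c] []; rewrite !mem_iota /= => jr cM ->.
    apply: (@le_trans _ _ (\prod_(a <- cell j c) 2^-1 : R)%R).
      rewrite big_seq [X in (_ <= X)%R]big_seq; apply: ler_prod => a a_cell.
      have [_ an _] := mem_cell jr cM a_cell.
      by rewrite kill_rate_ge0 kill_rate_cands.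
    by rewrite big_const_seq count_predT size_iota iter_mulr_1.
  rewrite big_const_seq count_predT iter_addr_0 size_allpairs !size_iota.
  rewrite -[X in (X < _)%R]mulr_natl exprVn ltr_pdivrMr ?exprn_gt0 ?ltr0n // mul1r -natrX ltr_nat.
  apply: leq_ltn_trans n_lt_exp2; apply: leq_trans r_le.
  by rewrite leq_mul // leq_div.
exists sel; split.
- move=> j jr rich; have [|p psel] := selC (take (2 * t) (block_primes H j)).
    by apply: map_f; rewrite mem_filter rich mem_iota; lia.
  move=> /mem_take; rewrite mem_filter mem_iota => /andP[_ pj]; exists p => //.
  by rewrite mulSn; lia.
- by move=> p /selP[C CC pC]; have [-> _ ->] := cand_primeP CC pC.
- move=> j c jr cM; have [|a aB asel] := selB (cell j c).
    by apply/allpairsP; exists (j, c); rewrite !mem_iota; split => //=; lia.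
  by exists a => //; apply/allP.
Qed.

Lemma exists_sidon_blocks : exists A : nat -> Prop,
  [/\ forall a, A a -> 0 < a <= n, sidon A &
      forall j, 0 < j <= r -> exists2 a, A a & j * H < a <= j.+1 * H].
Proof.
have [sel [sel_rich selP sel_cell]] := exists_prime_selection.
pose surv j c := [seq a <- cell j c | all (fun p => ~~ (p %| a)) sel].
(* The default 0 of [head] is never taken, as every cell has a survivor. *)
pose val (x : 'I_(size bad) * 'I_M) := head 0 (surv (nth 0 bad x.1) x.2).
have bad_mem (i : 'I_(size bad)) : 0 < nth 0 bad i <= r.
  have := mem_nth 0 (ltn_ord i); rewrite mem_filter mem_iota => /andP[_].
  by rewrite add1n ltnS.
have val_surv x : val x \in surv (nth 0 bad x.1) x.2.
  have [a a_cell a_sel] := sel_cell _ _ (bad_mem x.1) (ltn_ord x.2).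
  have : a \in surv (nth 0 bad x.1) x.2 by rewrite mem_filter a_sel.
  by rewrite /val; case: (surv _ _) => //= x0 s _; rewrite mem_head.
have val_cell x : val x \in cell (nth 0 bad x.1) x.2.
  by have := val_surv x; rewrite mem_filter => /andP[].
have valP x := mem_cell (bad_mem x.1) (ltn_ord x.2) (val_cell x).
have val_le x : 0 < val x <= n by have [] := valP x.
have val_gt0 x : 0 < val x by have /andP[] := val_le x.
have val_inj : injective val.
  move=> [i c] [j d] eq_val.
  have [_ _ [/= ij cd]] := valP (i, c); have [_ _ [/=]] := valP (j, d).
  rewrite -eq_val ij cd => /eqP; rewrite nth_uniq ?filter_uniq ?iota_uniq //.
  by move=> /eqP/val_inj -> /val_inj ->.
have div_le x y : size (divisors (val x * val y)) <= D.
  apply: divisors_le; rewrite muln_gt0 !val_gt0 -mulnn leq_mul //.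
    by have /andP[] := val_le x.
  by have /andP[] := val_le y.
have [||f fP] := exists_sidon_transversal R val_inj val_gt0 div_le _ _ M_gt0.
- apply: leq_trans (divisors_le (m := 1) _) => //.
  rewrite expn_gt0; apply/orP; left; apply: leq_trans r_le.
  by rewrite muln_gt0 (leq_trans M_gt0 (leq_div H b)).
- by rewrite card_ord.
exists (fun a => a \in sel \/ exists i, a = val (i, f i)); split.
- move=> a [/selP/andP[a_pr ->]|[i ->]]; last exact: val_le.
  by rewrite prime_gt0.
- apply: sidon_primesU => [p /selP/andP[]//|a [i ->]//|a p [i ->] pP|].
    by have := val_surv (i, f i); rewrite mem_filter => /andP[/allP/(_ p pP)].
  move=> _ _ _ _ [i ->] [j ->] [k ->] [l ->] /fP[[-> ->]|[-> ->]]; first by left.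
  by right.
- move=> j jr; have [j_poor|j_rich] := boolP (poor H (2 * t) j); last first.
    by have [p psel pj] := sel_rich j jr j_rich; exists p => //; left.
  have jbad : j \in bad by rewrite mem_filter j_poor mem_iota; lia.
  have lt_j : index j bad < size bad by rewrite index_mem.
  exists (val (Ordinal lt_j, f (Ordinal lt_j))); first by right; exists (Ordinal lt_j).
  by have [] := valP (Ordinal lt_j, f (Ordinal lt_j)); rewrite /= nth_index.
Qed.
End Blocks.

From mathcomp Require Import finmap.
From mathcomp Require Import all_classical all_reals all_analysis.

(** * From blocks to real intervals *)

Lemma prime_count_le (R : realType) (x y : R) (s : seq nat) :
  (forall p, prime p -> x < p%:R <= y -> p \in s) -> (prime_count x y <= size s)%N.
Proof.
move=> in_s; apply: uniq_leq_size (fset_uniq _) _ => p.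
rewrite in_fset_set ?inE; last exact: finite_primes_in.
by move=> [p_pr pxy]; apply: in_s.
Qed.

Local Open Scope classical_set_scope.

(** Blocks have length [2 * h] so that, for [x] in the first half, the interval (x, x + x^alpha], of
    length at most [h], stays inside the block. *)
Lemma poor_few_primes (R : realType) (alpha x : R) (n h k j : nat) :
  0 < alpha -> n%:R `^ alpha <= h%:R -> k%:R <= 5 `^ alpha^-1 :> R ->
  (j.+1 * (2 * h) <= n)%N -> poor (2 * h) k j ->
  `[(j * (2 * h))%:R, (j * (2 * h) + h)%:R] x -> few_primes alpha n x.
Proof.
move=> alpha0 le_h le_k jn j_poor; rewrite /= in_itv /= => /andP[jx xj].
have x0 : 0 <= x by apply: le_trans jx.
have xn : x <= n%:R by apply: le_trans xj _; rewrite ler_nat; lia.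
have xh : x `^ alpha <= h%:R.
  by apply: le_trans le_h; rewrite ge0_ler_powR ?nnegrE ?ler0n // ltW.
rewrite /few_primes /= x0 xn; split=> //; apply: lt_le_trans le_k.
rewrite ltr_nat; apply: leq_ltn_trans j_poor; apply: prime_count_le => p p_pr /andP[xp px].
rewrite mem_filter p_pr mem_iota /=.
have lt_p : (j * (2 * h) < p)%N by rewrite -(ltr_nat R) (le_lt_trans jx).
have : (p <= j * (2 * h) + h + h)%N.
  by rewrite -(ler_nat R) natrD (le_trans px) // lerD.
by move: lt_p; clear; lia.
Qed.

Lemma card_poor_le (R : realType) (alpha : R) (n h k r : nat) :
  0 < alpha -> n%:R `^ alpha <= h%:R -> k%:R <= 5 `^ alpha^-1 :> R ->
  (r.+1 * (2 * h) <= n)%N ->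
  (((size [seq j <- iota 1 r | poor (2 * h) k j]) * h)%:R%:E <=
    lebesgue_measure (few_primes alpha n))%E.
Proof.
move=> alpha0 le_h le_k rn; set bad := [seq j <- _ | _].
have [->|h_neq0] := eqVneq h 0; first by rewrite muln0 outer_measure_ge0.
pose F j : set R := `[(j * (2 * h))%:R, (j * (2 * h) + h)%:R].
have measF j : measurable (F j) by exact: measurable_itv.
have muF j : lebesgue_measure (F j) = h%:R%:E.
  rewrite /F lebesgue_measure_itv /= lte_fin ltr_nat -[X in (X < _)%N]addn0 ltn_add2l.
  by rewrite lt0n h_neq0 -EFinB natrD addrC addKr.
have trivF : trivIset [set` bad] F.
  move=> i j _ _ [x [] ]; rewrite /F /= !in_itv /= => /andP[ix xi] /andP[jx xj].
  have := le_trans ix xj; have := le_trans jx xi; rewrite !ler_nat.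
  by move: h_neq0; clear; case: (ltngtP i j) => // *; nia.
have uniq_bad : uniq bad by rewrite filter_uniq ?iota_uniq.
have sum_bad : lebesgue_measure (\bigcup_(j in [set` bad]) F j) = ((size bad) * h)%:R%:E.
  rewrite measure_fin_bigcup //; [|exact: finite_seq|by move=> j _; exact: measF].
  rewrite -fsbig_seq //= (eq_bigr (fun=> h%:R%:E)) //.
  by rewrite sumEFin big_const_seq count_predT iter_addr_0 natrM mulr_natl.
rewrite -sum_bad; apply: le_outer_measure => x [j /=].
rewrite mem_filter mem_iota => /andP[j_poor jr].
by apply: poor_few_primes => //; nia.
Qed.

(** An interval of length [2 * H] contains the first block (jH, (j + 1)H] with jH > x, and this has
    index at least 1. *)
Lemma sidon_gap_blocks (R : realType) (n H : nat) (A : nat -> Prop) :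
  (0 < H)%N -> (forall a, A a -> (0 < a <= n)%N) -> sidon A ->
  (forall j, (0 < j)%N -> (j.+1 * H <= n)%N ->
    exists2 a, A a & (j * H < a <= j.+1 * H)%N) ->
  sidon_gap n ((2 * H)%:R : R).
Proof.
move=> H0 A_le sidA blocks; split; first exact: ler0n.
exists A; split; first by move=> a /A_le; rewrite /=; lia.
  split; first by move=> a /A_le/andP[].
  move=> a b c d Aa Ab Ac Ad /(sidA _ _ _ _ Aa Ab Ac Ad)[[-> ->]//|[-> ->]].
  by rewrite setUC.
move=> x sub.
have le_x : x <= x + (2 * H)%:R by rewrite lerDl ler0n.
have /sub : `[x, x + (2 * H)%:R] x by rewrite /= in_itv /= lexx.
have /sub : `[x, x + (2 * H)%:R] (x + (2 * H)%:R) by rewrite /= in_itv /= lexx le_x.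
rewrite /= !in_itv /= => /andP[_ xn] /andP[x1 _].
have x0 : 0 <= x by apply: le_trans x1.
pose m := Num.truncn x; have /andP[mx xm] : m%:R <= x < m.+1%:R by apply: truncn_itv.
pose j := (m %/ H).+1.
have [||a Aa /andP[ja aj]] := blocks j => //.
  rewrite -(ler_nat R); apply: le_trans xn; apply: le_trans (_ : (m + 2 * H)%:R <= _).
    by rewrite ler_nat /j !mulSn; have := leq_divM m H; lia.
  by rewrite natrD lerD2r.
exists a%:R; split; first by exists a.
rewrite /= in_itv /=; apply/andP; split.
  apply: (le_trans (ltW xm)); rewrite ler_nat; apply: leq_trans ja.
  by rewrite ltnS ltnW // ltn_ceil.
apply: le_trans (_ : (m + 2 * H)%:R <= _); last by rewrite natrD lerD2r.
by rewrite ler_nat (leq_trans aj) // /j !mulSn; have := leq_divM m H; lia.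
Qed.

Lemma g_le (R : realType) (n : nat) (L : R) : sidon_gap n L -> g R n <= L.
Proof. by move=> gapL; apply: ge_inf => //; exists 0 => ? []. Qed.

(** No interval of length [n] fits inside [1, n], so even the empty set qualifies. This covers small
    [n] and [alpha >= 1]. *)
Lemma g_le_n (R : realType) (n : nat) : g R n <= n%:R.
Proof.
apply: g_le; split; first exact: ler0n.
exists set0; split=> [a []|| x sub]; first by split=> [a []|a b c d []].
have le_x : x <= x + n%:R by rewrite lerDl ler0n.
have /sub : `[x, x + n%:R] x by rewrite /= in_itv /= lexx.
have /sub : `[x, x + n%:R] (x + n%:R) by rewrite /= in_itv /= lexx le_x.
by rewrite /= !in_itv /=; lra.
Qed.

(** * Estimates for large n and choice of parameters *)

(** Otherwise [m ^ k] would exceed [n ^ 3], which is at least [C * n ^ 2]. Serves for the divisor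
    bound and for the cell length. *)
Lemma le_powR_root (R : realType) (eta : R) (k C n m : nat) :
  (0 < n)%N -> (C <= n)%N -> 3 <= eta * k%:R -> (m ^ k <= C * n ^ 2)%N ->
  m%:R <= n%:R `^ eta.
Proof.
move=> n0 Cn le3 le_m; rewrite leNgt; apply/negP => lt_m.
have k0 : (0 < k)%N by case: (k) le3 => //; rewrite mulr0; lra.
have : n%:R ^+ 3 < m%:R ^+ k :> R.
  apply: (@le_lt_trans _ _ ((n%:R `^ eta) ^+ k)).
    by rewrite -powR_mulrn ?ler0n // -powR_mulrn ?powR_ge0 // -powRrM ler_powR ?ler1n.
  by rewrite ltrXn2r ?powR_ge0 // -lt0n.
rewrite -!natrX ltr_nat ltnNge => /negP; apply; apply: leq_trans le_m _.
by rewrite [leqRHS]expnS leq_mul2r Cn orbT.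
Qed.

(* [u = n ^ eta] absorbs the divisor bound [D], the cell length [b] and the constant [80]. *)
Lemma bad_blocks_bound (R : realFieldType) (a u : R) (h b D M bad : nat) :
  0 < a -> a < h%:R -> 80 <= u -> D%:R <= u -> b%:R <= u -> (2 * h < M.+1 * b)%N -> (0 < M)%N ->
  (bad * h)%:R * u ^+ 4 <= a ^+ 3 ->
  (80 * D * bad <= M ^ 2)%N.
Proof.
move=> a0 ah u80 Du bu hM M0 bads.
have u0 : 0 < u by apply: lt_le_trans u80.
have aM : a <= M%:R * u.
  apply: le_trans (ltW ah) _; apply: le_trans (_ : (M * b)%:R <= _).
    by rewrite ler_nat; nia.
  by rewrite natrM ler_wpM2l.
have bad_a : bad%:R * u ^+ 4 <= a ^+ 2.
  rewrite -(ler_pM2l a0) -exprS; apply: le_trans bads; rewrite natrM.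
  by rewrite mulrCA mulrA ler_wpM2r ?exprn_ge0 ?(ltW u0) // ler_wpM2l ?ler0n // ltW.
have : 80 * D%:R * bad%:R * u ^+ 2 <= M%:R ^+ 2 * u ^+ 2.
  apply: le_trans (_ : bad%:R * u ^+ 4 <= _).
    have -> : 80 * D%:R * bad%:R * u ^+ 2 = bad%:R * u ^+ 2 * (80 * D%:R) by ring.
    have -> : bad%:R * u ^+ 4 = bad%:R * u ^+ 2 * (u * u) by ring.
    by apply: ler_wpM2l; [rewrite mulr_ge0 ?ler0n ?exprn_ge0 ?(ltW u0)|apply: ler_pM].
  apply: le_trans bad_a _; rewrite -exprMn ler_pXn2r ?nnegrE ?mulr_ge0 ?ler0n ?(ltW a0) ?(ltW u0) //.
by rewrite ler_pM2r ?exprn_gt0 // -natrX -!natrM ler_nat.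
Qed.

(** Puts [2 * t] below the threshold 5^(1/alpha) when [t] is the integer part of 1/alpha. *)
Lemma muln2_le_expn5 t : (2 * t <= 5 ^ t)%N.
Proof. by elim: t => // t IHt; rewrite expnS; have := expn_gt0 5 t; lia. Qed.

Theorem theorem3p2 (R : realType) (alpha : R) (alpha_gt0 : 0 < alpha)
    (lambda_lt : lambda alpha < 3 * alpha) :
  exists K : R, 0 < K /\
    forall n : nat, (0 < n)%N -> g R n <= K * n%:R `^ alpha.
Proof.
have [alpha1|alpha1] := leP 1 alpha.
  exists 1; split=> // n n0; rewrite mul1r; apply: le_trans (g_le_n R n) _.
  by rewrite -[X in X <= _]powRr1 // ler_powR ?ler1n.
set delta := (3 * alpha - lambda alpha) / 2.
have delta0 : 0 < delta by rewrite divr_gt0 // subr_gt0.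
(* [4 * eta <= delta] absorbs the fourth power in [bad_blocks_bound]; [eta <= alpha] makes a cell
   fit into a block. *)
pose eta := Num.min (delta / 4) alpha.
have eta0 : 0 < eta by rewrite lt_min alpha_gt0 divr_gt0.
have [_ /(_ _ delta0)[N0 _ few_small]] := lambda_exponent alpha.
pose k := (Num.truncn (3 / eta)).+1.
have le_k : 3 <= eta * k%:R.
  by rewrite mulrC -ler_pdivrMr // ltW // truncnS_gt.
have [C1 C1P] := divisors_bound k; pose C2 := (k`! * 2 ^ k)%N.
pose N1 := (Num.truncn (80 `^ eta^-1 : R)).+1.
(* From [N] on, the constants of the divisor and logarithm bounds are at most [n], the measure bound
   holds, and n^eta is at least 80. *)
pose N := (C1 + C2 + (N0 + N1))%N.
(* For [n < N] the trivial bound suffices; otherwise the gap is at most [2 * H = 4 * h], which is at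
   most 8 n^alpha. *)
exists (8 + N%:R); split; first by rewrite ltr_pwDl.
move=> n n0.
have n1 : 1 <= n%:R :> R by rewrite ler1n.
have a1 : 1 <= n%:R `^ alpha by rewrite -[X in X <= _](powRr0 n%:R) ler_powR // ltW.
have [nN|Nn] := ltnP n N.
  apply: le_trans (g_le_n R n) _; apply: le_trans (_ : N%:R <= _).
    by rewrite ler_nat ltnW.
  have : 0 <= N%:R :> R by [].
  move: (N%:R) => y y0; nra.
pose h := (Num.truncn (n%:R `^ alpha)).+1; pose H := (2 * h)%N.
have lt_h : n%:R `^ alpha < h%:R by apply: truncnS_gt.
have le_h : h%:R <= 2 * n%:R `^ alpha.
  have : (Num.truncn (n%:R `^ alpha))%:R <= n%:R `^ alpha.
    by have /andP[] := truncn_itv (le_trans ler01 a1).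
  by rewrite /h -natr1; lra.
have le_K (x : R) : x <= (2 * H)%:R -> x <= (8 + N%:R) * n%:R `^ alpha.
  move/le_trans; apply; rewrite !natrM.
  have : 0 <= N%:R * n%:R `^ alpha by rewrite mulr_ge0 // powR_ge0.
  by lra.
have [nH|Hn] := ltnP n H.
  by apply: le_K; apply: le_trans (g_le_n R n) _; rewrite ler_nat ltnW // (leq_trans nH) // leq_pmull.
apply: le_K.
pose t := Num.truncn alpha^-1; pose D := Num.truncn (n%:R `^ eta : R).
(* The successor ensures [n < 2 ^ b]; [r.+1] counts the complete blocks, block 0 included. *)
pose b := (trunc_log 2 n).+1; pose r := (n %/ H).-1.
have H0 : (0 < H)%N by [].
have r_le : (r.+1 * H <= n)%N by rewrite /r prednK ?divn_gt0 // leq_divM.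
have a0 : 0 < n%:R `^ alpha by apply: lt_le_trans a1.
have t0 : (0 < t)%N by rewrite truncn_gt0 invf_ge1 // ltW.
have u0 : 0 <= n%:R `^ eta by apply: powR_ge0.
have u80 : 80 <= n%:R `^ eta.
  have {1}-> : 80 = (80 `^ eta^-1) `^ eta :> R by rewrite -powRrM mulVf ?gt_eqF // powRr1.
  rewrite ge0_ler_powR ?nnegrE ?powR_ge0 ?ler0n ?ltW //.
  by apply: lt_le_trans (truncnS_gt _) _; rewrite ler_nat (leq_trans _ Nn) // /N addnA leq_addl.
have le_root m : (m ^ k <= (C1 + C2) * n ^ 2)%N -> m%:R <= n%:R `^ eta.
  apply: le_powR_root => //; apply: leq_trans Nn.
  by rewrite leq_addr.
have le_D : D%:R <= n%:R `^ eta by rewrite truncn_le.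
have D_bound m : (0 < m <= n ^ 2)%N -> (size (divisors m) <= D)%N.
  move=> /andP[m0 mn]; rewrite truncn_ge_nat //; apply: le_root.
  by apply: leq_trans (C1P m m0) _; rewrite leq_mul // leq_addr.
have le_b : b%:R <= n%:R `^ eta.
  apply: le_root; apply: leq_trans (expSn_leq_exp2 _ _) _.
  rewrite leq_mul ?leq_addl // (leq_trans (trunc_logP _ n0)) //.
  by rewrite -[X in (X <= _)%N]expn1 leq_pexp2l.
have bH : (b <= H)%N.
  apply: leq_trans (_ : h <= _)%N; last by rewrite leq_pmull.
  rewrite -(ler_nat R) (le_trans le_b) // (le_trans _ (ltW lt_h)) //.
  by rewrite ler_powR // ge_min lexx orbT.
(* n is the power 1/alpha of n^alpha, and 1/alpha < t + 1. *)
have n_lt : (n < H ^ t.+1)%N.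
  apply: (@leq_trans (h ^ t.+1)); last by rewrite leq_exp2r // leq_pmull.
  rewrite -(ltr_nat R) natrX; apply: le_lt_trans (_ : (n%:R `^ alpha) ^+ t.+1 < _).
    rewrite -powR_mulrn ?(ltW a0) // -[X in X <= _](powRr1 (ler0n _ _)).
    rewrite -[X in _ `^ X <= _](divff (lt0r_neq0 alpha_gt0)) powRrM ler_powR //.
    exact: ltW (truncnS_gt _).
  by rewrite ltrXn2r ?powR_ge0.
have k_le : (2 * t)%:R <= 5 `^ alpha^-1 :> R.
  apply: le_trans (_ : 5 `^ t%:R <= _).
    by rewrite powR_mulrn // -natrX ler_nat muln2_le_expn5.
  by rewrite ler_powR ?ler1n // truncn_le invr_ge0 ltW.
have Nn0 : (N0 <= n)%N by rewrite (leq_trans _ Nn) // /N addnCA leq_addr.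
have few_lt := le_lt_trans (card_poor_le alpha_gt0 (ltW lt_h) k_le r_le) (few_small n Nn0).
have M0 : (0 < H %/ b)%N by rewrite divn_gt0.
have [|A [A_le sidA A_blocks]] := exists_sidon_blocks R t0 n_lt (trunc_log_ltn n (ltnSn 1)) r_le M0 D_bound.
  apply: (bad_blocks_bound a0 lt_h u80 le_D le_b (ltn_ceil H _) M0) => //.
  move: few_lt; rewrite lte_fin => /ltW few_le.
  apply: le_trans (ler_wpM2r (exprn_ge0 4 u0) few_le) _.
  have n_neq0 : n%:R != 0 :> R by rewrite pnatr_eq0 -lt0n.
  (* It remains to compare exponents: [lambda alpha + delta + 4 * eta] is at most
     [lambda alpha + 2 * delta = 3 * alpha]. *)
  rewrite -!powR_mulrn ?(ltW a0) // -!powRrM -powRD ?n_neq0 ?implybT // ler_powR //.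
  have : eta <= delta / 4 by rewrite ge_min lexx.
  by rewrite /delta; lra.
apply: g_le; apply: sidon_gap_blocks H0 A_le sidA _ => j j0 jn; apply: A_blocks.
by rewrite j0 -ltnS /r prednK ?divn_gt0 // leq_divRL.
Qed.
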